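(* Let $\langle M,\ast,e\rangle$ be a cancellative abelian monoid which is conical (i.e. $x\ast y=e$ implies $x=y=e$ for $x,y\in M$), partially ordered by divisibility: $x\le y$ if and only if $y=x\ast a$ for some $a\in M$. Suppose that every element of $M$ is primal, that is, for all $x,a,b\in M$, $$x\leq a\ast b\ \Longrightarrow\ x=u\ast v\ \text{ for some } u,v\in M \text{ with } u\leq a \text{ and } v\leq b .$$ Then the group $G$ generated by $M$, ordered so that $M$ is its positive cone, is a Riesz group.
   Context: The group generated by the cancellative commutative monoid $M$ is its group of quotients $G=\{a\ast b^{-1}: a,b\in M\}$, ordered by $x\le y$ in $G$ if and only if $y=x\ast h$ for some $h\in M$. A Riesz group is a directed partially ordered (abelian) group $G$ having the Riesz interpolation property: for all $p,q,r,s\in G$ with $p\le r$, $p\le s$, $q\le r$, $q\le s$ there is $t\in G$ with $p\le t$, $q\le t$, $t\le r$, $t\le s$. *)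

(* Defs.v *)
From HB Require Import structures.
From mathcomp Require Import all_boot all_algebra.
From Corelib Require Relation_Definitions.

Set Implicit Arguments.
Unset Strict Implicit.
Unset Printing Implicit Defensive.

Import GRing.Theory.
Local Open Scope ring_scope.
Local Open Scope quotient_scope.

(* Commutative monoids are written additively: M is an nmodType, whose +, 0   *)
(* and subtraction in the group of quotients stand for *, e and a * b^-1.     *)

Definition cancellative (M : nmodType) : Prop := right_injective (@GRing.add M).

Definition conical (M : nmodType) : Prop :=
  forall x y : M, x + y = 0 -> x = 0 /\ y = 0.

(* Orders are Prop-valued, because divisibility need not be decidable. *)
Definition divides (M : nmodType) (x y : M) : Prop := exists a : M, y = x + a.

Definition primal (M : nmodType) (x : M) : Prop :=
  forall a b : M, divides x (a + b) ->
  exists u v : M, [/\ x = u + v, divides u a & divides v b].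

Section GroupOfQuotients.

Variables (M : nmodType) (cancM : cancellative M).

Implicit Types x y z : M * M.

(* The pair (a, b) represents a - b. *)
Definition equivq x y := x.1 + y.2 == y.1 + x.2.

Lemma equivq_refl : reflexive equivq.
Proof. by move=> x; rewrite /equivq. Qed.

Lemma equivq_sym : symmetric equivq.
Proof. by move=> x y; rewrite /equivq eq_sym. Qed.

(* cancM is an explicit argument of the quotient type through this lemma. *)
Lemma equivq_trans : transitive equivq.
Proof.
move=> y x z /eqP xy /eqP yz; rewrite /equivq; apply/eqP; apply: (@cancM y.2).
by rewrite addrCA addrA xy addrAC yz -addrA addrCA.
Qed.

Canonical equivq_equiv := EquivRel equivq equivq_refl equivq_sym equivq_trans.

Definition quotient_group := {eq_quot equivq_equiv}.

HB.instance Definition _ : EqQuotient _ equivq quotient_group :=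
  EqQuotient.on quotient_group.
HB.instance Definition _ := Choice.on quotient_group.

Definition addq x y : M * M := (x.1 + y.1, x.2 + y.2).
Definition oppq x : M * M := (x.2, x.1).

Definition quotient_add := lift_op2 quotient_group addq.
Definition quotient_opp := lift_op1 quotient_group oppq.
Definition quotient_zero : quotient_group := \pi_quotient_group (0, 0).

Lemma equivq_repr x : equivq (repr (\pi_quotient_group x)) x.
Proof. by rewrite -eqmodE reprK. Qed.

Lemma pi_quotient_add : {morph \pi : x y / addq x y >-> quotient_add x y}.
Proof.
move=> x y; unlock quotient_add; apply/eqmodP; rewrite /= /equivq /=.
by rewrite addrACA -(eqP (equivq_repr x)) -(eqP (equivq_repr y)) addrACA.
Qed.
Canonical pi_quotient_add_morph := PiMorph2 pi_quotient_add.

Lemma pi_quotient_opp : {morph \pi : x / oppq x >-> quotient_opp x}.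
Proof.
move=> x; unlock quotient_opp; apply/eqmodP; rewrite /= /equivq /=.
by rewrite addrC (eqP (equivq_repr x)) addrC.
Qed.
Canonical pi_quotient_opp_morph := PiMorph1 pi_quotient_opp.

Lemma quotient_addA : associative quotient_add.
Proof.
by elim/quotW=> x; elim/quotW=> y; elim/quotW=> z; rewrite !piE /addq !addrA.
Qed.

Lemma quotient_addC : commutative quotient_add.
Proof.
elim/quotW=> x; elim/quotW=> y; rewrite !piE /addq.
by rewrite [x.1 + _]addrC [x.2 + _]addrC.
Qed.

Lemma quotient_add0 : left_id quotient_zero quotient_add.
Proof. by elim/quotW=> [[a b]]; rewrite !piE /addq /= !add0r. Qed.

Lemma quotient_addN : left_inverse quotient_zero quotient_opp quotient_add.
Proof.
elim/quotW=> x; rewrite !piE; apply/eqmodP.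
by rewrite /= /equivq /= addr0 add0r addrC.
Qed.

HB.instance Definition _ := GRing.isZmodule.Build quotient_group
  quotient_addA quotient_addC quotient_add0 quotient_addN.

Definition quotient_inj (a : M) : quotient_group := \pi_quotient_group (a, 0).

Definition quotient_le (g h : quotient_group) : Prop :=
  exists a : M, h = g + quotient_inj a.

Lemma quotient_inj_is_nmod_morphism : nmod_morphism quotient_inj.
Proof.
split=> [//|a b].
by rewrite /quotient_inj -[RHS]pi_quotient_add /addq /= addr0.
Qed.

HB.instance Definition _ := GRing.isNmodMorphism.Build M quotient_group
  quotient_inj quotient_inj_is_nmod_morphism.

Lemma quotient_inj_injective : injective quotient_inj.
Proof.
move=> a b /eqmodP; rewrite /= /equivq /= !addr0.
by move/eqP.
Qed.

Lemma quotient_groupE (g : quotient_group) :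
  exists a b : M, g = quotient_inj a - quotient_inj b.
Proof.
elim/quotW: g => [[a b]]; exists a, b.
by rewrite /quotient_inj -[X in _ + X]pi_quotient_opp -[RHS]pi_quotient_add
  /addq /= addr0 add0r.
Qed.

Lemma quotient_le0 (g : quotient_group) :
  quotient_le 0 g <-> exists a : M, g = quotient_inj a.
Proof. by split=> -[a ->]; exists a; rewrite add0r. Qed.

End GroupOfQuotients.

Definition directed (T : Type) (le : T -> T -> Prop) : Prop :=
  forall x y, exists z, le x z /\ le y z.

Definition interpolation (T : Type) (le : T -> T -> Prop) : Prop :=
  forall p q r s, le p r -> le p s -> le q r -> le q s ->
  exists t, [/\ le p t, le q t, le t r & le t s].

Record riesz_group (G : zmodType) (le : G -> G -> Prop) : Prop := RieszGroup {
  riesz_order : Relation_Definitions.order G le;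
  riesz_leD2r : forall z x y : G, le x y -> le (x + z) (y + z);
  riesz_directed : directed le;
  riesz_interpolation : interpolation le
}.

(* Main.v *)
Require Import Defs.
From mathcomp Require Import all_boot all_algebra.

(** Antisymmetry of the order of [G] is conicality of [M], and directedness
    holds because every element of [G] is a difference of elements of [M].
    The content is interpolation.  Given [p, q] below [r, s], write
      r = p + a,  s = p + b,  r = q + c,  s = q + d   with a, b, c, d in M.
    Computing r + s in two ways gives b + c = a + d, so [a] divides [b + c].
    Primality splits a = u + v with b = u + u' and c = v + v', and t = p + u
    interpolates: r = t + v and s = t + u', while
      t + v = r = q + c = (q + v') + v
    gives t = q + v'.  Thus a single use of primality suffices, since the
    relation that is left over is forced by cancellation in [G]. *)

Import GRing.Theory.
Local Open Scope ring_scope.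

Section QuotientOrder.

Variables (M : nmodType) (cancM : cancellative M).

Let G := quotient_group cancM.
Let inj : M -> G := @quotient_inj M cancM.
Let le : G -> G -> Prop := @quotient_le M cancM.

Let injD a b : inj (a + b) = inj a + inj b.
Proof. exact: raddfD. Qed.

Lemma quotient_le_refl (x : G) : le x x.
Proof. by exists 0; rewrite raddf0 addr0. Qed.

Lemma quotient_le_trans (x y z : G) : le x y -> le y z -> le x z.
Proof. by move=> [a ->] [b ->]; exists (a + b); rewrite -addrA -injD. Qed.

Lemma quotient_le_anti : conical M ->
  forall x y : G, le x y -> le y x -> x = y.
Proof.
move=> conicalM x _ [a ->] [b xab].
have ab0 : a + b = 0.
  apply: (@quotient_inj_injective M cancM).
  rewrite -/inj injD /inj raddf0; apply: (addrI x).
  by rewrite addrA -xab addr0.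
by have [-> _] := conicalM _ _ ab0; rewrite raddf0 addr0.
Qed.

Lemma quotient_leD2r (z x y : G) : le x y -> le (x + z) (y + z).
Proof. by move=> [a ->]; exists a; rewrite addrAC. Qed.

(** A difference of elements of [M] is below its first term, so the sum of
    the two first terms bounds both elements. *)
Lemma quotient_le_directed : directed le.
Proof.
move=> x y.
have [a [b ->]] := quotient_groupE x; have [c [d ->]] := quotient_groupE y.
rewrite -/inj; exists (inj a + inj c); split.
  by exists (b + c); rewrite -/inj injD addrA subrK.
by exists (d + a); rewrite -/inj injD addrA subrK addrC.
Qed.

(** Two ways of going up from [p] and [q] to common bounds [r] and [s] yield
    a relation in [M], to which primality applies. *)
Lemma quotient_le_square {p q r s : G} {a b c d : M} :
  r = p + inj a -> s = p + inj b -> r = q + inj c -> s = q + inj d ->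
  b + c = a + d.
Proof.
move=> rpa spb rqc sqd; apply: (@quotient_inj_injective M cancM).
rewrite -/inj !injD; apply: (addrI (p + q)).
by rewrite addrACA -spb -rqc addrACA -rpa -sqd addrC.
Qed.

Lemma primal_interpolation : (forall x : M, primal x) -> interpolation le.
Proof.
move=> primalM p q r s [a rpa] [b spb] [c rqc] [d sqd].
have bc_ad := quotient_le_square rpa spb rqc sqd.
have [|u [v [a_uv [u' b_uu'] [v' c_vv']]]] := primalM a b c; first by exists d.
exists (p + inj u); split.
- by exists u.
- (* both sides become [r] after adding [v] *)
  exists v'; apply: (addIr (inj v)).
  by rewrite -/inj -!addrA -!injD -a_uv [v' + v]addrC -c_vv' -rpa.
- by exists v; rewrite rpa a_uv -/inj injD addrA.
- by exists u'; rewrite spb b_uu' -/inj injD addrA.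
Qed.

End QuotientOrder.

Theorem theorem2p3 (M : nmodType) (cancM : cancellative M)
    (conicalM : conical M) (primalM : forall x : M, primal x) :
  riesz_group (@quotient_le M cancM).
Proof.
split.
- split.
  + exact: quotient_le_refl.
  + exact: quotient_le_trans.
  + exact: quotient_le_anti.
- exact: quotient_leD2r.
- exact: quotient_le_directed.
- exact: primal_interpolation.
Qed.
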